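(* Let $\{x_k\}$ be the sequence of iterates generated by the Noisy Trust-Region Algorithm (described in the context), and suppose that Assumptions (A1)–(A5) of the context hold, with $\epsilon_g>0$. Let $$r=\frac{2}{1-c_2},\quad M=\tfrac12(L_B+L),\quad \beta=\sqrt{(r\epsilon_g)^2+8\nu r^2\left(\tfrac1{c_0}-1\right)M\epsilon_f},\quad \gamma=\tfrac12\left(-r\epsilon_g+\beta\right)+\tfrac{\epsilon_g}{2},$$ $$C_1=\left\{x\in\mathbb{R}^n:\ \|g(x)\|\le (r+1)\epsilon_g+\frac{\beta}{2}\right\},$$ $$G=\left[(r+1)\epsilon_g+\gamma+\frac{\nu^2L\gamma}{(\nu-1)rM}\right]\frac{\nu^2\gamma}{(\nu-1)rM}.$$ Then, after the iterates $x_k$ visit $C_1$ for the first time, they never leave the set $$C_2=\left\{x\in\mathbb{R}^n:\ f(x)\le\sup_{y\in C_1}f(y)+2\epsilon_f+\max\left[G,\ r(1-c_0)\epsilon_f\right]\right\};$$ that is, if $k_1$ is the first index with $x_{k_1}\in C_1$, then $x_k\in C_2$ for all $k\ge k_1$ (the supremum is allowed to be $+\infty$).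
   Context: $\|\cdot\|$ is the Euclidean norm (and the induced matrix norm). $f:\mathbb{R}^n\to\mathbb{R}$ is the objective, $g=\nabla f$. Only noisy values $\tilde f(x)=f(x)+\delta_f(x)$ and $\tilde g(x)=g(x)+\delta_g(x)$ are available, where $\delta_f:\mathbb{R}^n\to\mathbb{R}$, $\delta_g:\mathbb{R}^n\to\mathbb{R}^n$ are error functions. Write $\tilde f_k=\tilde f(x_k)$, $g_k=g(x_k)$, $\tilde g_k=\tilde g(x_k)$. Noisy Trust-Region Algorithm. Parameters: $0<c_0\le c_1<c_2<1$, $\nu>1$, $r=2/(1-c_2)$ (so $r>2$), starting point $x_0$, initial radius $\Delta_0>0$. For $k=0,1,2,\dots$ (without termination), let $$m_k(p)=\tilde f(x_k)+\tilde g_k^Tp+\tfrac12p^T\tilde B_kp,$$ where $\tilde B_k$ is a symmetric $n\times n$ matrix; compute $p_k$ with $\|p_k\|\le\Delta_k$ as an exact or approximate solution of $\min_p m_k(p)$ s.t. $\|p\|\le\Delta_k$; and set $$\rho_k=\frac{\tilde f(x_k)-\tilde f(x_k+p_k)+r\epsilon_f}{m_k(0)-m_k(p_k)+r\epsilon_f}.$$ If $\rho_k<c_1$ set $\Delta_{k+1}=\Delta_k/\nu$; else if $\rho_k>c_2$ set $\Delta_{k+1}=\nu\Delta_k$; else $\Delta_{k+1}=\Delta_k$. If $\rho_k>c_0$ (step accepted) set $x_{k+1}=x_k+p_k$; otherwise $x_{k+1}=x_k$. The algorithm is assumed well defined, i.e. the denominator of $\rho_k$ is nonzero for every $k$ (automatic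 if $\epsilon_f>0$). Cauchy step: $p_k^c=-\tau_k\frac{\Delta_k}{\|\tilde g_k\|}\tilde g_k$, where $\tau_k=1$ if $\tilde g_k^T\tilde B_k\tilde g_k\le0$ and $\tau_k=\min\left(\|\tilde g_k\|^3/(\Delta_k\tilde g_k^T\tilde B_k\tilde g_k),1\right)$ otherwise ($p_k^c=0$ if $\tilde g_k=0$). Assumptions: (A1) $f$ is continuously differentiable and $\|g(x)-g(y)\|<L\|x-y\|$ for all $x\ne y$. (A2) $|\delta_f(x)|\le\epsilon_f$ and $\|\delta_g(x)\|\le\epsilon_g$ for all $x\in\mathbb{R}^n$, where $\epsilon_f,\epsilon_g\ge0$ are constants. (A3) There is a constant $L_B>0$ with $\|\tilde B_k\|<L_B$ for all $k$. (A4) For all $k$, $m_k(0)-m_k(p_k)\ge m_k(0)-m_k(p_k^c)\ge\frac12\|\tilde g_k\|\min\left(\Delta_k,\|\tilde g_k\|/\|\tilde B_k\|\right)$, the minimum being read as $\Delta_k$ if $\tilde B_k=0$. (A5) The sequence $\{\tilde f_k\}$ is bounded below. *)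

(* Defs.v *)
From HB Require Import structures.
From mathcomp Require Import all_boot all_order all_algebra.
From mathcomp Require Import all_classical all_reals all_analysis.

Set Implicit Arguments.
Unset Strict Implicit.
Unset Printing Implicit Defensive.

Import Order.TTheory GRing.Theory Num.Theory.
Import numFieldNormedType.Exports.

Local Open Scope classical_set_scope.
Local Open Scope ring_scope.

Definition dotv (R : realType) (n : nat) (u v : 'cV[R]_n) : R :=
  (u^T *m v) ord0 ord0.

(* The norm `|v| that the library puts on matrices is the sup norm; it induces
   the same topology, hence the same notions of continuity and
   differentiability, but all metric quantities below use this norm. *)
Definition enorm (R : realType) (n : nat) (v : 'cV[R]_n) : R :=
  Num.sqrt (dotv v v).

(* The set below is nonempty and bounded above, so this real-valued [sup] is
   the true supremum. *)
Definition opnorm (R : realType) (n : nat) (A : 'M[R]_n) : R :=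
  sup [set enorm (A *m v) | v in [set v : 'cV[R]_n | enorm v <= 1]].

Definition gradient (R : realType) (n : nat) (f : 'cV[R]_n -> R)
    (x : 'cV[R]_n) : 'cV[R]_n :=
  \col_(i < n) 'D_(delta_mx i ord0) f x.

Definition continuously_differentiable (R : realType) (n : nat)
    (f : 'cV[R]_n -> R) : Prop :=
  (forall x, differentiable f x) /\ continuous (gradient f).

(* [a], [g] and [B] are the noisy function value, the noisy gradient and the
   Hessian approximation at the current iterate. *)
Definition model (R : realType) (n : nat) (a : R) (g : 'cV[R]_n) (B : 'M[R]_n)
    (p : 'cV[R]_n) : R :=
  a + dotv g p + 2^-1 * dotv p (B *m p).

Definition cauchy_tau (R : realType) (n : nat) (g : 'cV[R]_n) (B : 'M[R]_n)
    (Delta : R) : R :=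
  if dotv g (B *m g) <= 0 then 1
  else Num.min (enorm g ^+ 3 / (Delta * dotv g (B *m g))) 1.

(* This is 0 when g = 0, as it should be. *)
Definition cauchy_step (R : realType) (n : nat) (g : 'cV[R]_n) (B : 'M[R]_n)
    (Delta : R) : 'cV[R]_n :=
  - (cauchy_tau g B Delta * (Delta / enorm g)) *: g.

(* min (Delta, |g| / |B|), with |g| / |B| read as +oo when B = 0 (a division by
   0 would return 0). *)
Definition cauchy_radius (R : realType) (n : nat) (g : 'cV[R]_n) (B : 'M[R]_n)
    (Delta : R) : R :=
  if B == 0 then Delta else Num.min Delta (enorm g / opnorm B).

Definition rho_den (R : realType) (n : nat) (ft : 'cV[R]_n -> R)
    (gt : 'cV[R]_n -> 'cV[R]_n) (r epsf : R) (B : 'M[R]_n)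
    (x p : 'cV[R]_n) : R :=
  model (ft x) (gt x) B 0 - model (ft x) (gt x) B p + r * epsf.

Definition rho (R : realType) (n : nat) (ft : 'cV[R]_n -> R)
    (gt : 'cV[R]_n -> 'cV[R]_n) (r epsf : R) (B : 'M[R]_n)
    (x p : 'cV[R]_n) : R :=
  (ft x - ft (x + p) + r * epsf) / rho_den ft gt r epsf B x p.

(* A run of the algorithm with observed function [ft] and gradient [gt]:
   iterates [x], steps [p], radii [Delta], matrices [B].  How p_k approximates
   a minimizer of the model is not part of this record: it is constrained only
   by the Cauchy decrease condition, a separate hypothesis. *)
Record noisy_trust_region (R : realType) (n : nat) (ft : 'cV[R]_n -> R)
    (gt : 'cV[R]_n -> 'cV[R]_n) (r epsf c0 c1 c2 nu : R)
    (x p : nat -> 'cV[R]_n) (Delta : nat -> R) (B : nat -> 'M[R]_n) : Prop := {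
  ntr_radius0 : 0 < Delta 0%N ;
  ntr_sym : forall k, (B k)^T = B k ;
  ntr_step : forall k, enorm (p k) <= Delta k ;
  ntr_den : forall k, rho_den ft gt r epsf (B k) (x k) (p k) != 0 ;
  ntr_radius : forall k, Delta k.+1 =
    let rho_k := rho ft gt r epsf (B k) (x k) (p k) in
    if rho_k < c1 then Delta k / nu
    else if c2 < rho_k then nu * Delta k else Delta k ;
  ntr_iter : forall k, x k.+1 =
    let rho_k := rho ft gt r epsf (B k) (x k) (p k) in
    if c0 < rho_k then x k + p k else x k }.

(* Main.v *)
Require Import Defs.
From HB Require Import structures.
From mathcomp Require Import all_boot all_order all_algebra.
From mathcomp Require Import all_classical all_reals all_analysis.
From mathcomp Require Import ring lra.

(** Write theta = gamma / (nu r M).  The argument compares the radius with two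
    levels, theta and nu theta = gamma / (r M), and follows an excursion of the
    iterates outside C1.

    Outside C1 the observed gradient is longer than r epsg + gamma, so as long
    as Delta_k <= nu theta the predicted decrease dominates both the curvature
    error M Delta_k^2 and the gradient error epsg Delta_k.  Then the step is
    very successful: the radius is multiplied by nu, and the exact objective f
    does not increase (small_radius_succeeds).  Hence, outside C1, once the
    radius has reached theta it stays at least theta
    (large_radius_persists), and while Delta_k >= theta the predicted decrease
    is large enough for every accepted step to satisfy
    c0 pred_k >= r (1 - c0) epsf; this is the choice of beta.  So the observed
    objective does not increase (large_radius_decreases).

    Consequently an excursion has at most two phases: first f is nonincreasing,
    while the radius grows geometrically, then the observed objective is.  The
    change of quantity, together with the final return to f, costs at most
    2 epsf.  The only other loss occurs in the step that leaves C1
    (exit_controlled).  If the radius after that step is below theta, the step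
    has length at most nu theta and starts where the gradient is at most
    (r + 1) epsg + beta / 2, so by Taylor expansion f grows by at most G;
    otherwise acceptance bounds the growth of the observed objective by
    r (1 - c0) epsf.  No geometric series of step lengths has to be summed,
    because the growth phase itself decreases f. *)

Set Implicit Arguments.
Unset Strict Implicit.
Unset Printing Implicit Defensive.

Import Order.TTheory GRing.Theory Num.Theory.
Import numFieldNormedType.Exports.

Local Open Scope classical_set_scope.
Local Open Scope ring_scope.

(** * Euclidean and operator norms *)

Section Euclidean.
Variables (R : realType) (n : nat).
Implicit Types (u v w : 'cV[R]_n) (A : 'M[R]_n).

Lemma dotvE u v : dotv u v = \sum_i u i ord0 * v i ord0.
Proof. by rewrite /dotv mxE; apply: eq_bigr => i _; rewrite mxE. Qed.

Lemma dotvC u v : dotv u v = dotv v u.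
Proof. by rewrite !dotvE; apply: eq_bigr => i _; rewrite mulrC. Qed.

Lemma dotvDl u v w : dotv (u + v) w = dotv u w + dotv v w.
Proof.
by rewrite !dotvE -big_split; apply: eq_bigr => i _; rewrite mxE mulrDl.
Qed.

Lemma dotvZl a u v : dotv (a *: u) v = a * dotv u v.
Proof.
by rewrite !dotvE mulr_sumr; apply: eq_bigr => i _; rewrite mxE mulrA.
Qed.

Lemma dotvNl u v : dotv (- u) v = - dotv u v.
Proof. by rewrite -scaleN1r dotvZl mulN1r. Qed.

Lemma dotvBl u v w : dotv (u - v) w = dotv u w - dotv v w.
Proof. by rewrite dotvDl dotvNl. Qed.

Lemma dotvDr u v w : dotv w (u + v) = dotv w u + dotv w v.
Proof. by rewrite dotvC dotvDl !(dotvC _ w). Qed.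

Lemma dotvZr a u v : dotv v (a *: u) = a * dotv v u.
Proof. by rewrite dotvC dotvZl dotvC. Qed.

Lemma dotvNr u v : dotv v (- u) = - dotv v u.
Proof. by rewrite dotvC dotvNl dotvC. Qed.

Lemma dotv0 u : dotv u 0 = 0.
Proof. by rewrite -(scale0r u) dotvZr mul0r. Qed.

Lemma dotv_ge0 u : 0 <= dotv u u.
Proof. by rewrite dotvE sumr_ge0 // => i _; rewrite -expr2 sqr_ge0. Qed.

Lemma dotv_eq0 u : dotv u u = 0 -> u = 0.
Proof.
rewrite dotvE => /eqP; rewrite psumr_eq0; last first.
  by move=> i _; rewrite -expr2 sqr_ge0.
move=> /allP u0; apply/matrixP => i j; rewrite ord1 mxE.
have := u0 i (mem_index_enum i).
by rewrite mulf_eq0 orbb => /eqP.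
Qed.

Lemma enorm_ge0 u : 0 <= enorm u.
Proof. exact: sqrtr_ge0. Qed.

Lemma enorm_sqr u : enorm u ^+ 2 = dotv u u.
Proof. exact/sqr_sqrtr/dotv_ge0. Qed.

Lemma enorm0 : enorm (0 : 'cV[R]_n) = 0.
Proof. by rewrite /enorm dotv0 sqrtr0. Qed.

Lemma enorm_eq0 u : enorm u = 0 -> u = 0.
Proof. by move=> u0; apply: dotv_eq0; rewrite -enorm_sqr u0 expr0n. Qed.

Lemma enormZ a u : enorm (a *: u) = `|a| * enorm u.
Proof.
by rewrite /enorm dotvZl dotvZr mulrA -expr2 sqrtrM ?sqr_ge0// sqrtr_sqr.
Qed.

Lemma enorm_leP u a : 0 <= a -> (enorm u <= a) = (dotv u u <= a ^+ 2).
Proof. by move=> a0; rewrite -enorm_sqr ler_sqr// nnegrE// enorm_ge0. Qed.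

(** For nonzero vectors, the squared norm of |v| u - |u| v is
    2 |u| |v| (|u| |v| - u.v). *)
Lemma cauchy_schwarz u v : dotv u v <= enorm u * enorm v.
Proof.
have [/enorm_eq0 ->|u0] := eqVneq (enorm u) 0.
  by rewrite enorm0 mul0r dotvC dotv0.
have [/enorm_eq0 ->|v0] := eqVneq (enorm v) 0; first by rewrite enorm0 mulr0 dotv0.
have uv0 : 0 < enorm u * enorm v.
  by apply: mulr_gt0; rewrite lt_neqAle enorm_ge0 eq_sym ?u0 ?v0.
rewrite -subr_ge0 -(pmulr_rge0 _ uv0).
have := dotv_ge0 (enorm v *: u - enorm u *: v).
rewrite dotvBl !dotvZl !dotvDr !dotvNr !dotvZr -!enorm_sqr (dotvC v u); lra.
Qed.

Lemma enormD u v : enorm (u + v) <= enorm u + enorm v.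
Proof.
rewrite enorm_leP; last by rewrite addr_ge0 ?enorm_ge0.
have := cauchy_schwarz u v.
rewrite dotvDl !dotvDr -!enorm_sqr (dotvC v u); lra.
Qed.

Lemma enormN u : enorm (- u) = enorm u.
Proof. by rewrite -scaleN1r enormZ normrN1 mul1r. Qed.

(** The Frobenius norm bounds the image of the unit ball; this is what makes
    the supremum defining the operator norm a genuine least upper bound. *)
Lemma opnorm_has_ubound A :
  has_ubound [set enorm (A *m v) | v in [set v : 'cV[R]_n | enorm v <= 1]].
Proof.
pose F := \sum_i enorm (row i A)^T ^+ 2.
exists (Num.sqrt F) => _ /= [v v1 <-].
have F0 : 0 <= F by apply: sumr_ge0 => i _; exact: sqr_ge0.
rewrite ler_sqrt// dotvE; apply: ler_sum => i _.
have -> : (A *m v) i ord0 = dotv (row i A)^T v.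
  by rewrite dotvE mxE; apply: eq_bigr => j _; rewrite !mxE.
rewrite -expr2 -real_normK ?num_real// ler_sqr ?nnegrE ?enorm_ge0//.
have rle w : enorm w <= 1 -> dotv (row i A)^T w <= enorm (row i A)^T.
  by move=> w1; rewrite (le_trans (cauchy_schwarz _ _))// ler_piMr// enorm_ge0.
by rewrite ler_norml rle// andbT lerNl -dotvNr rle// enormN.
Qed.

Lemma enorm_mulmx A v : enorm (A *m v) <= opnorm A * enorm v.
Proof.
have [/enorm_eq0 ->|v0] := eqVneq (enorm v) 0.
  by rewrite mulmx0 enorm0 mulr0.
have vp : 0 < enorm v by rewrite lt_neqAle enorm_ge0 eq_sym v0.
rewrite -ler_pdivrMr// mulrC.
have -> : (enorm v)^-1 * enorm (A *m v) = enorm (A *m ((enorm v)^-1 *: v)).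
  by rewrite -scalemxAr enormZ ger0_norm// invr_ge0 enorm_ge0.
apply: ub_le_sup; first exact: opnorm_has_ubound.
exists ((enorm v)^-1 *: v) => //=.
by rewrite enormZ ger0_norm ?invr_ge0 ?enorm_ge0// mulVf.
Qed.

(** Needed because the Cauchy radius divides by the operator norm. *)
Lemma opnorm_gt0 A : A != 0 -> 0 < opnorm A.
Proof.
apply: contra_neqT; rewrite -leNgt => A0; apply/matrixP => i j.
have -> : A i j = (A *m (delta_mx j ord0 : 'cV_n)) i ord0 by rewrite -colE mxE.
suff -> : A *m (delta_mx j ord0 : 'cV_n) = 0 by rewrite !mxE.
apply: enorm_eq0; apply/eqP; rewrite eq_le enorm_ge0 andbT.
by rewrite (le_trans (enorm_mulmx _ _))// mulr_le0_ge0 ?enorm_ge0.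
Qed.

Lemma opnormN A : opnorm (- A) = opnorm A.
Proof.
by congr sup; apply/seteqP; split=> _ [v v1 <-]; exists v => //; rewrite mulNmx enormN.
Qed.

Lemma quadratic_form_le A v c : opnorm A <= c ->
  dotv v (A *m v) <= c * enorm v ^+ 2.
Proof.
move=> Ac; rewrite (le_trans (cauchy_schwarz _ _))//.
rewrite expr2 mulrCA ler_wpM2l ?enorm_ge0//.
by rewrite (le_trans (enorm_mulmx _ _))// ler_wpM2r ?enorm_ge0.
Qed.

End Euclidean.

(** * The descent lemma *)

Section DescentLemma.
Variables (R : realType) (n : nat) (f : 'cV[R]_n -> R).
Hypothesis f_diff : forall x, differentiable f x.

Lemma diff_gradient x v : 'd f x v = dotv (gradient f x) v.
Proof.
have {1}-> : v = \sum_(i < n) v i ord0 *: delta_mx i ord0.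
  rewrite {1}[v]matrix_sum_delta; apply: eq_bigr => i _.
  by rewrite big_ord1.
rewrite linear_sum dotvE; apply: eq_bigr => i _.
by rewrite linearZ /= mxE deriveE// mulrC.
Qed.

Lemma is_derive_line x v (t : R) :
  is_derive t 1 (fun s : R => f (x + s *: v)) (dotv (gradient f (x + t *: v)) v).
Proof.
have h : is_diff t (fun s : R => x + s *: v) (fun s => s *: v).
  have -> : (fun s : R => x + s *: v) = cst x + ( *:%R ^~ v) by [].
  rewrite -[X in is_diff _ _ X]add0r.
  exact: is_diffD (is_diff_cst _ _) (is_diff_scalel _ _).
have fd : is_diff (x + t *: v) f ('d f (x + t *: v)) by exact: DiffDef.
have dl : is_diff t (f \o (fun s : R => x + s *: v))
   ('d f (x + t *: v) \o (fun s => s *: v)) by exact: is_diff_comp.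
have dd : differentiable (fun s : R => f (x + s *: v)) t by case: dl.
apply: DeriveDef; first exact/derivable1_diffP.
rewrite deriveE// -diff_gradient.
have -> : 'd (fun s : R => f (x + s *: v)) t =
   'd f (x + t *: v) \o (fun s => s *: v) :> (R -> R) by case: dl.
by rewrite /= scale1r.
Qed.

(** Descent lemma: along the segment from [x] to [x + v] the derivative of
    [f] exceeds its initial value by at most [L t |v|^2], so subtracting the
    corresponding quadratic leaves a nonincreasing function of [t]. *)
Lemma descent_lemma L x v :
  (forall y z, enorm (gradient f y - gradient f z) <= L * enorm (y - z)) ->
  f (x + v) <= f x + dotv (gradient f x) v + L / 2 * enorm v ^+ 2.
Proof.
move=> gL; pose a := dotv (gradient f x) v; pose b := L / 2 * enorm v ^+ 2.
pose phi := fun s : R => f (x + s *: v) - (s * a + s ^+ 2 * b).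
pose dphi := fun s : R => dotv (gradient f (x + s *: v)) v - (a + 2 * s * b).
have phiE (s : R) : is_derive s 1 phi (dphi s).
  have d1 := is_derive_line x v s.
  have d2 : is_derive s (1 : R) (fun s : R => s * a + s ^+ 2 * b) (a + 2 * s * b).
    have -> : (fun s : R => s * a + s ^+ 2 * b) = (a \*: id) + (b \*: (id ^+ 2)).
      by apply/funext => u; rewrite fctE /= mulrC [_ * b]mulrC.
    apply: is_derive_eq; rewrite /= expr1 !scaler1 /GRing.scale/=; ring.
  exact: is_deriveB.
have [|c] := @MVT _ phi dphi 0 1 ltr01 (fun s _ => phiE s).
  apply: derivable_within_continuous => s _; case: (phiE s) => //.
rewrite in_itv /= => /andP[c0 c1].
rewrite /phi scale0r addr0 scale1r subr0 mulr1 expr1n !mul1r mul0r expr0n /= mul0r.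
rewrite addr0 subr0 => E.
suff : dphi c <= 0 by rewrite -E -/a -/b; lra.
rewrite /dphi opprD addrA -dotvBl subr_le0 (le_trans (cauchy_schwarz _ _))//.
apply: (@le_trans _ _ (L * enorm (x + c *: v - x) * enorm v)).
  by rewrite ler_wpM2r ?enorm_ge0.
rewrite addrAC subrr add0r enormZ gtr0_norm// /b le_eqVlt; apply/orP; left.
by apply/eqP; field.
Qed.

End DescentLemma.

(** * The model and the Cauchy radius *)

Section CauchyRadius.
Variables (R : realType) (n : nat).
Implicit Types (gt p : 'cV[R]_n) (B : 'M[R]_n).

(** The Cauchy radius involves the norm of the current matrix, and a special
    value for the zero matrix; this replaces it by the uniform bound [LB]. *)
Lemma cauchy_radius_ge gt B Delta LB theta :
  0 < LB -> opnorm B <= LB -> theta <= Delta -> theta * LB <= enorm gt ->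
  theta <= cauchy_radius gt B Delta.
Proof.
move=> LB0 BLB tD tLB; rewrite /cauchy_radius.
have [//|B0] := eqVneq B 0.
rewrite le_min tD /= ler_pdivlMr ?opnorm_gt0//.
have [t0|t0] := leP 0 theta; first by rewrite (le_trans _ tLB)// ler_wpM2l.
by rewrite (le_trans _ (enorm_ge0 _))// mulr_le0_ge0// ltW// opnorm_gt0.
Qed.

Lemma model_decrease (a : R) gt B p :
  model a gt B 0 - model a gt B p = - (dotv gt p + 2^-1 * dotv p (B *m p)).
Proof. by rewrite /model dotv0 mulmx0 dotv0; ring. Qed.

End CauchyRadius.

(** * Inequalities between the constants *)

Section Constants.
Variables (R : realType) (epsf epsg c0 nu r M beta gamma : R).
Hypotheses (c0_gt0 : 0 < c0) (c0_lt1 : c0 < 1) (nu_gt1 : 1 < nu) (r_gt2 : 2 < r).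
Hypotheses (epsf_ge0 : 0 <= epsf) (epsg_gt0 : 0 < epsg) (M_gt0 : 0 < M).
Hypothesis beta_def : beta = Num.sqrt ((r * epsg) ^+ 2
                + 8 * nu * r ^+ 2 * (1 / c0 - 1) * M * epsf).
Hypothesis gamma_def : gamma = 2^-1 * (- (r * epsg) + beta) + epsg / 2.

Let r_gt0 : 0 < r.
Proof. exact: lt_trans r_gt2. Qed.

Let nu_gt0 : 0 < nu.
Proof. exact: lt_trans nu_gt1. Qed.

Let noise_term_ge0 : 0 <= 8 * nu * r ^+ 2 * (1 / c0 - 1) * M * epsf.
Proof.
have h : 0 <= 1 / c0 - 1 by rewrite subr_ge0 mul1r invf_ge1// ltW.
have n0 := nu_gt0.
by rewrite !mulr_ge0// ltW// r_gt0.
Qed.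

Let beta_sqr :
  beta ^+ 2 = (r * epsg) ^+ 2 + 8 * nu * r ^+ 2 * (1 / c0 - 1) * M * epsf.
Proof. by rewrite beta_def sqr_sqrtr// addr_ge0// ?sqr_ge0// noise_term_ge0. Qed.

Let repsg_gt0 : 0 < r * epsg.
Proof. by rewrite mulr_gt0// r_gt0. Qed.

Lemma le_beta : r * epsg <= beta.
Proof.
have b0 : 0 <= beta by rewrite beta_def sqrtr_ge0.
rewrite -ler_sqr ?nnegrE//; last exact/ltW/repsg_gt0.
by rewrite beta_sqr lerDl noise_term_ge0.
Qed.

Lemma gamma_gt0 : 0 < gamma.
Proof. by rewrite gamma_def; move: le_beta epsg_gt0; lra. Qed.

Lemma threshold_gt0 : 0 < gamma / (nu * r * M).
Proof. by rewrite divr_gt0 ?gamma_gt0// !mulr_gt0 ?nu_gt0 ?r_gt0. Qed.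

(** The value of [beta] is dictated by this inequality: the right-hand side is
    [c0] times the decrease predicted at radius gamma / (nu r M) for an observed
    gradient of length r epsg + beta / 2, and with s = r epsg it is at least
    c0 (beta - s) (beta + s) / (8 nu r M), because gamma >= (beta - s) / 2;
    the definition of [beta] makes this the left-hand side. *)
Lemma threshold_decrease :
  (1 - c0) * r * epsf <=
  c0 * (2^-1 * (r * epsg + beta / 2) * (gamma / (nu * r * M))).
Proof.
have [n0 r0] := (nu_gt0, r_gt0).
have D0 : 0 < nu * r * M by rewrite !mulr_gt0.
have [nz1 nz2 nz3] : [/\ nu != 0, r != 0 & M != 0] by rewrite !gt_eqF.
have E : (1 - c0) * r * epsf =
    c0 * ((beta ^+ 2 - (r * epsg) ^+ 2) / (8 * (nu * r * M))).
  by rewrite beta_sqr; field; rewrite nz1 nz2 nz3 gt_eqF.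
rewrite E ler_pM2l// ler_pdivrMr ?mulr_gt0//.
have -> : 2^-1 * (r * epsg + beta / 2) * (gamma / (nu * r * M)) * (8 * (nu * r * M))
    = 4 * (r * epsg + beta / 2) * gamma.
  by field; rewrite nz1 nz2 nz3.
have gh : 2^-1 * (beta - r * epsg) <= gamma by rewrite gamma_def; move: epsg_gt0; lra.
have s0 : 0 <= r * epsg by rewrite ltW// repsg_gt0.
have := le_beta => bs.
apply: (@le_trans _ _ (4 * (r * epsg + beta / 2) * (2^-1 * (beta - r * epsg)))).
  have : 0 <= (r * epsg) * (beta - r * epsg) by rewrite mulr_ge0// subr_ge0.
  lra.
by apply: ler_wpM2l => //; lra.
Qed.

(** The left-hand side is the Taylor bound for the growth of the objective in
    the step leaving C1.  There beta / 2 = gamma + (r - 1) epsg / 2, which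
    exceeds the gamma of the right-hand side; the factor
    nu^2 / (nu - 1) >= 4 absorbs the difference. *)
Lemma exit_increase_le L Delta : 0 < L -> 0 <= Delta -> Delta <= gamma / (r * M) ->
  ((r + 1) * epsg + beta / 2) * Delta + L / 2 * Delta ^+ 2 <=
  ((r + 1) * epsg + gamma + nu ^+ 2 * L * gamma / ((nu - 1) * r * M))
    * (nu ^+ 2 * gamma / ((nu - 1) * r * M)).
Proof.
move=> L0 D0 Dd; have r0 := r_gt0.
set d := gamma / (r * M) in Dd *.
pose q := nu ^+ 2 / (nu - 1).
have nu10 : 0 < nu - 1 by rewrite subr_gt0.
have q4 : 4 <= q.
  (* nu^2 - 4 (nu - 1) is the square of nu - 2. *)
  by rewrite /q ler_pdivlMr// -subr_ge0 (_ : _ - _ = (nu - 2) ^+ 2) ?sqr_ge0//; ring.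
have [nz1 nz2 nz3] : [/\ nu - 1 != 0, r != 0 & M != 0] by rewrite !gt_eqF.
have -> : nu ^+ 2 * L * gamma / ((nu - 1) * r * M) = L * (q * d).
  by rewrite /q /d; field; rewrite nz1 nz2 nz3.
have -> : nu ^+ 2 * gamma / ((nu - 1) * r * M) = q * d.
  by rewrite /q /d; field; rewrite nz1 nz2 nz3.
have bE : beta / 2 = gamma + (r - 1) / 2 * epsg by rewrite gamma_def; field.
rewrite bE.
have Dq : 4 * Delta <= q * d by apply: ler_pM => //.
have g0 := gamma_gt0.
have e1 : 0 <= r * epsg by rewrite ltW// repsg_gt0.
set a := (r + 1) * epsg + gamma.
have a0 : 0 <= a by rewrite /a; move: epsg_gt0; lra.
have h1 : 4 * a * Delta <= a * (q * d).
  by rewrite mulrAC mulrC ler_wpM2l// mulrC.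
have h2 : (r - 1) / 2 * epsg * Delta <= a * Delta.
  by rewrite ler_wpM2r// /a; move: epsg_gt0; lra.
have h3 : Delta ^+ 2 <= (q * d) ^+ 2.
  by rewrite ler_sqr ?nnegrE//; lra.
have h4 : L / 2 * Delta ^+ 2 <= L * (q * d) * (q * d).
  have : L * Delta ^+ 2 <= L * (q * d) ^+ 2 by rewrite ler_pM2l.
  have : 0 <= L * Delta ^+ 2 by rewrite mulr_ge0 ?sqr_ge0// ltW.
  lra.
have h5 : 0 <= a * Delta by rewrite mulr_ge0.
have -> : ((r + 1) * epsg + (gamma + (r - 1) / 2 * epsg)) = a + (r - 1) / 2 * epsg.
  by rewrite /a; ring.
lra.
Qed.

End Constants.

(** * Runs of the noisy trust-region algorithm *)

Section NoisyTrustRegion.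
Variables (R : realType) (n : nat).
Variables (f deltaf : 'cV[R]_n -> R) (deltag : 'cV[R]_n -> 'cV[R]_n).
Variables (epsf epsg L LB c0 c1 c2 nu : R).
Variables (x p : nat -> 'cV[R]_n) (Delta : nat -> R) (B : nat -> 'M[R]_n).
Hypotheses (c0_gt0 : 0 < c0) (c0_le_c1 : c0 <= c1) (c1_lt_c2 : c1 < c2).
Hypotheses (c2_lt1 : c2 < 1) (nu_gt1 : 1 < nu).
Let g := gradient f.
Let ft := fun y => f y + deltaf y.
Let gt := fun y => g y + deltag y.
Variables (r M beta gamma theta W : R).
Hypothesis r_def : r = 2 / (1 - c2).
Hypothesis run : noisy_trust_region ft gt r epsf c0 c1 c2 nu x p Delta B.
Hypothesis f_diff : forall y, differentiable f y.
Hypothesis L_gt0 : 0 < L.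
Hypothesis g_lip : forall y z, enorm (g y - g z) <= L * enorm (y - z).
Hypotheses (epsf_ge0 : 0 <= epsf) (epsg_gt0 : 0 < epsg).
Hypothesis deltaf_le : forall y, `|deltaf y| <= epsf.
Hypothesis deltag_le : forall y, enorm (deltag y) <= epsg.
Hypotheses (LB_gt0 : 0 < LB) (B_le : forall k, opnorm (B k) <= LB).
Hypothesis M_def : M = 2^-1 * (LB + L).
Hypothesis beta_def : beta = Num.sqrt ((r * epsg) ^+ 2
                + 8 * nu * r ^+ 2 * (1 / c0 - 1) * M * epsf).
Hypothesis gamma_def : gamma = 2^-1 * (- (r * epsg) + beta) + epsg / 2.
Hypothesis theta_def : theta = gamma / (nu * r * M).
Hypothesis short_exit_le_W : ((r + 1) * epsg + gamma
              + nu ^+ 2 * L * gamma / ((nu - 1) * r * M))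
           * (nu ^+ 2 * gamma / ((nu - 1) * r * M)) <= W.
Hypothesis long_exit_le_W : r * (1 - c0) * epsf <= W.

Let pred k := model (ft (x k)) (gt (x k)) (B k) 0
              - model (ft (x k)) (gt (x k)) (B k) (p k).
Let rho_at k := rho ft gt r epsf (B k) (x k) (p k).
Let C1 y := enorm (g y) <= (r + 1) * epsg + beta / 2.

Hypothesis sufficient_decrease : forall k,
  2^-1 * enorm (gt (x k)) * cauchy_radius (gt (x k)) (B k) (Delta k) <= pred k.

Let c2_r : r * (1 - c2) = 2.
Proof. by rewrite r_def divfK// subr_eq0 gt_eqF. Qed.

Lemma ratio_gt2 : 2 < r.
Proof.
have c20 : 0 < c2 by rewrite (lt_trans _ c1_lt_c2)// (lt_le_trans c0_gt0).
by rewrite r_def ltr_pdivlMr ?subr_gt0// mulrBr mulr1 gtrBl mulr_gt0.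
Qed.

Let r_pos : 0 < r. Proof. exact: lt_trans ratio_gt2. Qed.

Let c0_lt1 : c0 < 1.
Proof. by rewrite (le_lt_trans c0_le_c1)// (lt_trans c1_lt_c2). Qed.

Let nu_pos : 0 < nu. Proof. exact: lt_trans nu_gt1. Qed.

Lemma curvature_gt0 : 0 < M.
Proof. by rewrite M_def mulr_gt0// addr_gt0. Qed.

Lemma radius_gt0 k : 0 < Delta k.
Proof.
elim: k => [|k IH]; first exact: ntr_radius0 run.
rewrite (ntr_radius run) /=.
by case: ifP => _; [rewrite divr_gt0|case: ifP => // _; rewrite mulr_gt0].
Qed.

(** A short radius after a step means that the step itself was short. *)
Lemma radius_ratio k : Delta k <= nu * Delta k.+1.
Proof.
have D0 := radius_gt0 k; rewrite (ntr_radius run) /=.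
have n0 := nu_pos.
case: ifP => _; first by rewrite mulrC divfK// gt_eqF.
have h : Delta k <= nu * Delta k by rewrite ler_peMl// ltW.
by case: ifP => // _; rewrite (le_trans h)// ler_pM2l.
Qed.

(** Monotonicity in the radius frees the sufficient decrease condition from the
    Cauchy radius; [t] will be the current radius for short steps and the
    threshold [theta] for long ones. *)
Lemma pred_ge t k : 0 <= t -> t <= Delta k -> t * LB <= enorm (gt (x k)) ->
  2^-1 * enorm (gt (x k)) * t <= pred k.
Proof.
move=> t0 tD tLB; apply: le_trans (sufficient_decrease k).
rewrite ler_wpM2l ?mulr_ge0 ?enorm_ge0//.
exact: cauchy_radius_ge LB_gt0 (B_le k) tD tLB.
Qed.

Lemma pred_ge0 k : 0 <= pred k.
Proof.
have := @pred_ge 0 k (lexx 0); rewrite mulr0 mul0r; apply.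
- exact/ltW/radius_gt0.
- exact: enorm_ge0.
Qed.

Lemma den_gt0 k : 0 < pred k + r * epsf.
Proof.
rewrite lt_neqAle eq_sym (ntr_den run k) /=.
by rewrite addr_ge0 ?pred_ge0// mulr_ge0// ltW.
Qed.

Lemma lt_rho c k :
  (c < rho_at k) = (c * (pred k + r * epsf) < ft (x k) - ft (x k + p k) + r * epsf).
Proof. by rewrite /rho_at /rho ltr_pdivlMr// den_gt0. Qed.

(** The Lipschitz bound contributes L / 2 and the model curvature LB / 2 to the
    quadratic error, which together make [M]; only the noise in the gradient
    enters, since the exact objective is compared with the model decrease. *)
Lemma objective_le k :
  f (x k + p k) <= f (x k) - pred k + epsg * Delta k + M * Delta k ^+ 2.
Proof.
have pD := ntr_step run k; have p0 := enorm_ge0 (p k).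
have h1 := descent_lemma f_diff (x k) (p k) g_lip.
have h2 : - dotv (deltag (x k)) (p k) <= epsg * Delta k.
  rewrite -dotvNl (le_trans (cauchy_schwarz _ _))// enormN.
  by rewrite ler_pM ?enorm_ge0.
have h3 : - dotv (p k) (B k *m p k) <= LB * enorm (p k) ^+ 2.
  by rewrite -dotvNr -mulNmx quadratic_form_le ?opnormN.
have h4 : M * enorm (p k) ^+ 2 <= M * Delta k ^+ 2.
  rewrite ler_pM2l ?curvature_gt0// ler_sqr ?nnegrE// (le_trans p0) //.
have E : M * enorm (p k) ^+ 2 = 2^-1 * (LB * enorm (p k) ^+ 2) + L / 2 * enorm (p k) ^+ 2.
  by rewrite M_def; field.
rewrite /pred model_decrease {1}/gt dotvDl.
move: h1 h2 h3 h4; rewrite E -/g; lra.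
Qed.

Lemma noise_le y z : deltaf y - deltaf z <= 2 * epsf.
Proof.
have := deltaf_le y; have := deltaf_le z.
by rewrite !ler_norml => /andP[? ?] /andP[? ?]; lra.
Qed.

(** With e = epsg Delta + M Delta^2 the error of the model, the hypothesis makes
    the predicted decrease larger than r e / 2.  As r > 2 this exceeds e, so the
    exact objective decreases; as r (1 - c2) = 2 it also leaves room for the
    noise 2 epsf, so the ratio exceeds c2. *)
Lemma short_step_succeeds k :
  r * epsg + r * M * Delta k < enorm (gt (x k)) ->
  c2 < rho_at k /\ f (x k + p k) <= f (x k).
Proof.
move=> big; have D0 := radius_gt0 k; have M0 := curvature_gt0.
have r2 := ratio_gt2; have r0 := r_pos.
have LBM : LB <= 2 * M by rewrite M_def; move: L_gt0; lra.
have LBle : Delta k * LB <= enorm (gt (x k)).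
  apply: le_trans (ltW big); rewrite mulrC -[leLHS]add0r lerD//.
    by rewrite mulr_ge0 ?ltW.
  by rewrite ler_pM2r// (le_trans LBM)// ler_pM2r// ltW.
have h1 := pred_ge (ltW D0) (lexx _) LBle.
have h2 : (r * epsg + r * M * Delta k) * Delta k < enorm (gt (x k)) * Delta k.
  by rewrite ltr_pM2r.
pose e := epsg * Delta k + M * Delta k ^+ 2.
have e0 : 0 < e by rewrite addr_gt0// ?mulr_gt0// exprn_gt0.
have h3 : r * e < 2 * pred k.
  have -> : r * e = (r * epsg + r * M * Delta k) * Delta k by rewrite /e; ring.
  by move: h1 h2; lra.
have h4 : 2 * e < r * e by rewrite ltr_pM2r.
have h5 := objective_le k.
split; last by move: h3 h4 h5; rewrite /e; lra.
rewrite lt_rho /ft -(ltr_pM2l r0).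
have -> : r * (c2 * (pred k + r * epsf)) =
    r * (pred k + r * epsf) - (r * (1 - c2)) * (pred k + r * epsf) by ring.
rewrite c2_r.
have h6 := noise_le (x k + p k) (x k).
have : r * (f (x k) + deltaf (x k) - (f (x k + p k) + deltaf (x k + p k)) + r * epsf)
   >= r * (pred k - e - 2 * epsf + r * epsf).
  by rewrite ler_pM2l//; move: h5 h6; rewrite /e; lra.
apply: lt_le_trans; move: h3; lra.
Qed.

Lemma observed_gradient_gt k : ~ C1 (x k) -> r * epsg + beta / 2 < enorm (gt (x k)).
Proof.
move=> /negP; rewrite -ltNge => big.
have h : enorm (g (x k)) <= enorm (gt (x k)) + enorm (deltag (x k)).
  have -> : g (x k) = gt (x k) + - deltag (x k) by rewrite /gt addrK.
  by rewrite (le_trans (enormD _ _))// enormN.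
by move: big h (deltag_le (x k)); lra.
Qed.

Lemma theta_pos : 0 < theta.
Proof.
rewrite theta_def; exact: (threshold_gt0 c0_gt0 c0_lt1 nu_gt1 ratio_gt2 epsf_ge0 epsg_gt0
  curvature_gt0 beta_def gamma_def).
Qed.

Lemma observed_gradient_gt_gamma k : ~ C1 (x k) -> r * epsg + gamma < enorm (gt (x k)).
Proof.
move=> /observed_gradient_gt; apply: le_lt_trans; rewrite gamma_def.
have : 2 * epsg < r * epsg by rewrite ltr_pM2r// ratio_gt2.
by move: epsg_gt0; lra.
Qed.

Lemma theta_scale : r * M * (nu * theta) = gamma.
Proof. by rewrite theta_def; field; rewrite !gt_eqF// curvature_gt0. Qed.

Lemma small_radius_succeeds k : ~ C1 (x k) -> Delta k <= nu * theta ->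
  c2 < rho_at k /\ f (x k + p k) <= f (x k).
Proof.
move=> nC Dk; apply: short_step_succeeds.
apply: le_lt_trans (observed_gradient_gt_gamma nC); rewrite lerD2l -theta_scale.
by rewrite ler_pM2l// mulr_gt0// curvature_gt0.
Qed.

Lemma growing_step k : c2 < rho_at k ->
  Delta k.+1 = nu * Delta k /\ x k.+1 = x k + p k.
Proof.
move=> s; rewrite (ntr_radius run) (ntr_iter run) /= -/(rho_at k) s.
rewrite ifF; last by apply/negbTE; rewrite -leNgt ltW// (lt_trans c1_lt_c2).
by rewrite ifT// (le_lt_trans c0_le_c1)// (lt_trans c1_lt_c2).
Qed.

(** Between [theta] and nu [theta] the radius still grows, and above
    nu [theta] it can only shrink by the factor nu. *)
Lemma large_radius_persists k : ~ C1 (x k) -> theta <= Delta k ->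
  theta <= Delta k.+1.
Proof.
move=> nC tD; have D0 := radius_gt0 k; have [Dk|Dk] := leP (Delta k) (nu * theta).
  have [/growing_step[-> _] _] := small_radius_succeeds nC Dk.
  by rewrite (le_trans tD)// ler_peMl// ltW.
by rewrite -(ler_pM2l nu_pos) (le_trans (ltW Dk))// radius_ratio.
Qed.

Lemma accepted_step k : c0 < rho_at k ->
  ft (x k + p k) <= ft (x k) - c0 * pred k + r * (1 - c0) * epsf.
Proof. by rewrite lt_rho => h; move: (ltW h); lra. Qed.

Lemma large_radius_decreases k : ~ C1 (x k) -> theta <= Delta k ->
  ft (x k.+1) <= ft (x k).
Proof.
move=> nC tD; rewrite (ntr_iter run) /= -/(rho_at k).
case: ifP => // /accepted_step h; apply: (le_trans h).
have t0 := theta_pos.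
have tLB : theta * LB <= enorm (gt (x k)).
  apply: le_trans (ltW (observed_gradient_gt_gamma nC)).
  rewrite -[leLHS]add0r lerD//; first by rewrite mulr_ge0 ?ltW.
  rewrite -theta_scale [leRHS](_ : _ = theta * (r * M * nu)); last by ring.
  rewrite ler_pM2l// (@le_trans _ _ (2 * M))//.
    by rewrite M_def; move: L_gt0; lra.
  have h1 : 2 * M <= r * M by rewrite ler_pM2r ?curvature_gt0// ltW// ratio_gt2.
  by rewrite (le_trans h1)// ler_peMr ?mulr_ge0// ltW// curvature_gt0.
have h1 := pred_ge (ltW t0) tD tLB.
have h2 := threshold_decrease c0_gt0 c0_lt1 nu_gt1 ratio_gt2 epsf_ge0 epsg_gt0
  curvature_gt0 beta_def gamma_def.
have h3 : c0 * (2^-1 * (r * epsg + beta / 2) * theta) <= c0 * pred k.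
  rewrite ler_pM2l// (le_trans _ h1)// ler_pM2r// ler_pM2l//.
  exact/ltW/observed_gradient_gt.
by move: h2 h3; rewrite -theta_def; lra.
Qed.

(** The invariant of an excursion that left C1 at the point [z]: the exact
    objective is controlled while the radius grows towards [theta], the observed
    one afterwards.  Passing from the first to the second uses up one
    [epsf]. *)
Let controlled z k :=
  if Delta k < theta then f (x k) <= f z + W else ft (x k) <= f z + epsf + W.

Lemma ft_le y : ft y <= f y + epsf.
Proof. by rewrite lerD2l (le_trans (ler_norm _))// deltaf_le. Qed.

Lemma f_le y : f y <= ft y + epsf.
Proof.
rewrite /ft; have := deltaf_le y; rewrite ler_norml => /andP[? _]; lra.
Qed.

(** The only step of an excursion that contributes to [W]; the two lower bounds
    on [W] correspond to its two cases, a short and a long step. *)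
Lemma exit_controlled k : C1 (x k) -> ~ C1 (x k.+1) -> controlled (x k) k.+1.
Proof.
move=> C nC.
have acc : c0 < rho_at k.
  by apply: contra_notT nC => /negbTE h; rewrite (ntr_iter run) /= -/(rho_at k) h.
have xk : x k.+1 = x k + p k by rewrite (ntr_iter run) /= -/(rho_at k) acc.
rewrite /controlled; case: ltP => [small|_]; last first.
  have h1 := accepted_step acc; have h2 := ft_le (x k).
  have h4 : 0 <= c0 * pred k by rewrite mulr_ge0 ?pred_ge0 ?(ltW c0_gt0).
  by rewrite xk; move: h1 h2 h4 long_exit_le_W; lra.
have Dk : Delta k <= gamma / (r * M).
  have -> : gamma / (r * M) = nu * theta.
    by rewrite -theta_scale; field; rewrite !gt_eqF// curvature_gt0.
  by rewrite (le_trans (radius_ratio k)) ?ler_pM2l ?(ltW small).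
have := exit_increase_le c0_gt0 c0_lt1 nu_gt1 ratio_gt2 epsf_ge0 epsg_gt0
  curvature_gt0 beta_def gamma_def L_gt0 (ltW (radius_gt0 k)) Dk.
move=> /le_trans /(_ short_exit_le_W) hG.
have h1 := descent_lemma f_diff (x k) (p k) g_lip.
have pD := ntr_step run k; have p0 := enorm_ge0 (p k).
have h2 : dotv (g (x k)) (p k) <= ((r + 1) * epsg + beta / 2) * Delta k.
  by apply: (le_trans (cauchy_schwarz _ _)); exact: ler_pM (enorm_ge0 _) p0 C pD.
have h3 : L / 2 * enorm (p k) ^+ 2 <= L / 2 * Delta k ^+ 2.
  by rewrite ler_wpM2l ?(divr_ge0 (ltW L_gt0))// lerXn2r ?nnegrE ?(le_trans p0).
by rewrite xk; move: h1 h2 h3 hG; rewrite -/g; lra.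
Qed.

Lemma controlled_step z k : ~ C1 (x k) -> controlled z k -> controlled z k.+1.
Proof.
move=> nC; rewrite {1}/controlled; case: ltP => [small|large] h.
  have small' : Delta k <= nu * theta.
    by rewrite (le_trans (ltW small))// ler_peMl// ?ltW// theta_pos.
  have [/growing_step[_ xk] fd] := small_radius_succeeds nC small'.
  have h1 : f (x k.+1) <= f z + W by rewrite xk (le_trans fd).
  rewrite /controlled; case: ifP => // _.
  by rewrite (le_trans (ft_le _))// -addrA [epsf + _]addrC addrA lerD2r.
have large' := large_radius_persists nC large.
rewrite /controlled ltNge large' /=.
exact: le_trans (large_radius_decreases nC large) h.
Qed.

Lemma iterates_controlled k1 k : C1 (x k1) -> (k1 <= k)%N ->
  C1 (x k) \/ exists2 z, C1 z & controlled z k.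
Proof.
move=> Ck1; elim: k => [|k IH].
  by rewrite leqn0 => /eqP k10; left; move: Ck1; rewrite k10.
rewrite leq_eqVlt => /predU1P[<-|k1k]; first by left.
have [C|nC] := pselect (C1 (x k.+1)); [by left|right].
have [C'|nC'] := pselect (C1 (x k)).
  by exists (x k); [exact: C'|exact: exit_controlled].
case: (IH k1k) => [/nC' []|[z Cz cz]].
by exists z; [exact: Cz|exact: controlled_step].
Qed.

Lemma objective_bounded k1 k : C1 (x k1) -> (k1 <= k)%N ->
  exists2 z, C1 z & f (x k) <= f z + (2 * epsf + W).
Proof.
have W0 : 0 <= W.
  apply: le_trans long_exit_le_W.
  by rewrite !mulr_ge0// ?subr_ge0 ltW.
move=> Ck1 /(iterates_controlled Ck1)[C|[z Cz]].
  by exists (x k); [exact: C|move: W0 epsf_ge0; lra].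
rewrite /controlled => zk; exists z; first exact: Cz.
by move: zk (f_le (x k)); case: ifP => _; move: W0 epsf_ge0; lra.
Qed.

End NoisyTrustRegion.

Theorem theorem7 (R : realType) (n : nat)
  (f deltaf : 'cV[R]_n -> R) (deltag : 'cV[R]_n -> 'cV[R]_n)
  (epsf epsg L LB c0 c1 c2 nu : R)
  (x p : nat -> 'cV[R]_n) (Delta : nat -> R) (B : nat -> 'M[R]_n)
  (c0_gt0 : 0 < c0) (c0_le_c1 : c0 <= c1) (c1_lt_c2 : c1 < c2)
  (c2_lt1 : c2 < 1) (nu_gt1 : 1 < nu) :
  let g := gradient f in
  let ft := fun y => f y + deltaf y in
  let gt := fun y => g y + deltag y in
  let r := 2 / (1 - c2) in
  noisy_trust_region ft gt r epsf c0 c1 c2 nu x p Delta B ->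
  (* (A1) *)
  continuously_differentiable f ->
  (forall y z, y != z -> enorm (g y - g z) < L * enorm (y - z)) ->
  (* (A2) *)
  0 <= epsf -> 0 < epsg ->
  (forall y, `|deltaf y| <= epsf) ->
  (forall y, enorm (deltag y) <= epsg) ->
  (* (A3) *)
  0 < LB -> (forall k, opnorm (B k) < LB) ->
  (* (A4) *)
  (forall k,
     let m := model (ft (x k)) (gt (x k)) (B k) in
     let pc := cauchy_step (gt (x k)) (B k) (Delta k) in
     m 0 - m (p k) >= m 0 - m pc /\
     m 0 - m pc >=
       2^-1 * enorm (gt (x k)) * cauchy_radius (gt (x k)) (B k) (Delta k)) ->
  (* (A5) *)
  has_lbound (range (fun k => ft (x k))) ->
  let M := 2^-1 * (LB + L) in
  let beta := Num.sqrt ((r * epsg) ^+ 2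
                + 8 * nu * r ^+ 2 * (1 / c0 - 1) * M * epsf) in
  let gamma := 2^-1 * (- (r * epsg) + beta) + epsg / 2 in
  let C1 := [set y : 'cV[R]_n | enorm (g y) <= (r + 1) * epsg + beta / 2] in
  let G := ((r + 1) * epsg + gamma
              + nu ^+ 2 * L * gamma / ((nu - 1) * r * M))
           * (nu ^+ 2 * gamma / ((nu - 1) * r * M)) in
  let C2 := [set y : 'cV[R]_n |
    ((f y)%:E <= ereal_sup [set (f z)%:E | z in C1]
                 + (2 * epsf + Num.max G (r * (1 - c0) * epsf))%:E)%E] in
  forall k1 : nat,
    C1 (x k1) -> (forall k, (k < k1)%N -> ~ C1 (x k)) ->
    forall k, (k1 <= k)%N -> C2 (x k).
Proof.
move=> g ft gt r run [f_diff _] g_lip ef0 eg0 dfle dgle LB0 BLB A4 _.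
move=> M beta gamma C1 G C2 k1 Ck1 _ k k1k.
(* A bound by the value at one point of C1 suffices, so finiteness of the
   supremum is never an issue. *)
suff [z Cz fz] : exists2 z, C1 z & f (x k) <= f z + (2 * epsf
    + Num.max G (r * (1 - c0) * epsf)).
  rewrite /C2 /=; apply: (@le_trans _ _ ((f z)%:E + (2 * epsf
    + Num.max G (r * (1 - c0) * epsf))%:E)%E); first by rewrite -EFinD lee_fin.
  by rewrite leeD2r//; apply: ereal_sup_ubound; exists z.
have [C|nC] := pselect (C1 (x k)).
  exists (x k) => //; rewrite lerDl addr_ge0 ?mulr_ge0// le_max.
  apply/orP; right; rewrite !mulr_ge0 ?invr_ge0 ?subr_ge0 ?(ltW c2_lt1)//.
  by rewrite ltW// (le_lt_trans c0_le_c1)// (lt_trans c1_lt_c2).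
(* C1 and its complement are both inhabited, so there are two distinct points;
   in dimension 0 the Lipschitz hypothesis would not determine the sign of L. *)
have L_gt0 : 0 < L.
  have xx : x k != x k1 by apply: contra_notN nC => /eqP ->.
  have := le_lt_trans (enorm_ge0 _) (g_lip _ _ xx).
  by rewrite pmulr_lgt0// lt_neqAle enorm_ge0 eq_sym andbT; apply: contraNneq xx
    => /enorm_eq0/eqP; rewrite subr_eq0.
have g_lipw y z : enorm (g y - g z) <= L * enorm (y - z).
  have [->|yz] := eqVneq y z; first by rewrite !subrr enorm0 mulr0.
  exact/ltW/g_lip.
have dec j : 2^-1 * enorm (gt (x j)) * cauchy_radius (gt (x j)) (B j) (Delta j)
    <= model (ft (x j)) (gt (x j)) (B j) 0
       - model (ft (x j)) (gt (x j)) (B j) (p j).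
  by have [h1 h2] := A4 j; exact: le_trans h2 h1.
have GW : G <= Num.max G (r * (1 - c0) * epsf) by rewrite le_max lexx.
have eW : r * (1 - c0) * epsf <= Num.max G (r * (1 - c0) * epsf).
  by rewrite le_max lexx orbT.
exact: (objective_bounded c0_gt0 c0_le_c1 c1_lt_c2 c2_lt1 nu_gt1 erefl run f_diff
  L_gt0 g_lipw ef0 eg0 dfle dgle LB0 (fun j => ltW (BLB j)) erefl erefl erefl
  erefl GW eW dec Ck1 k1k).
Qed.
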